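(* Let $E$ be a Borel space and $Q$ a semi-Markov kernel on $\mathbb{R}_+\times E$ given $E$ satisfying: there exist $\delta>0$, $\epsilon>0$ with $Q(\delta,E\mid x)\le1-\epsilon$ for all $x\in E$. Let $c,g:E\to[0,\infty)$ be measurable and $T\in\mathbb{R}_+$. For each stopping time $\tau$, let $\pi_\tau=\{d^\tau_n,n\ge0\}$ be the policy induced by $\tau$. Then $$V^\tau(s,x)=U^{\pi_\tau}(s,x)=V^{\tau^s_{\pi_\tau}}(s,x)\qquad\text{for all }(s,x)\in[0,T]\times E,$$ where $\tau^s_{\pi_\tau}$ is the stopping time induced by $\pi_\tau$ and $s$.
   Context: SMP: Semi-Markov kernel means: for each $B\in\mathcal{B}(E)$, $x$, $t\mapsto Q(t,B\mid x)$ nondecreasing, right-continuous, $Q(0,B\mid x)=0$; $Q(t,\cdot\mid\cdot)$ substochastic; $\lim_{t\to\infty}Q(t,\cdot\mid\cdot)$ stochastic. $\Omega=\{(x_0,t_1,x_1,\dots): x_0\in E,(t_n,x_n)\in\mathbb{R}_+\times E\}$; $X_n(\omega)=x_n$, $T_0=0$, $T_{n+1}(\omega)=t_{n+1}$, $S_n=\sum_{k=0}^nT_k$, $Y_n=(X_0,T_1,X_1,\dots,T_n,X_n)$, $\mathcal{F}_n=\sigma(T_0,X_0,\dots,T_n,X_n)$; $\mathbb{P}_x$ is the unique probability with $\mathbb{P}_x(T_0=0,X_0=x)=1$ and $\mathbb{P}_x(T_{n+1}\le t,X_{n+1}\in B\mid Y_n)=Q(t,B\mid X_n)$, $\mathbb{E}_x$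 its expectation; $X(t)=X_n$ for $S_n\le t<S_{n+1}$. A stopping time is $\tau:\Omega\to\mathbb{N}\cup\{\infty\}$ ($\mathbb{N}=\{0,1,\dots\}$) with $\{\tau=n\}\in\mathcal{F}_n$. $R^s_\tau=\int_0^{S_\tau}c(X(t))\,dt+g(X(S_\tau))$ if $S_\tau<s$, and $\int_0^sc(X(t))\,dt$ if $S_\tau\ge s$ ($S_\tau=\lim_nS_n$ on $\{\tau=\infty\}$); $V^\tau(s,x)=\mathbb{E}_x[R^s_\tau]$. Constructed SMDP: $\hat E=E\cup\{\Delta\}$, $A=\{0,1\}$, $A(x)=\{0,1\}$ for $x\in E$, $A(\Delta)=\{1\}$; $\hat Q_T(t,B\mid x,0)=Q(t,B\setminus\{\Delta\}\mid x)$ for $x\in E$, $\hat Q_T(t,B\mid x,1)=\mathbf{1}_{[T+1,\infty)}(t)\delta_\Delta(B)$ for $x\in\hat E$; $\hat c(x,a)=c(x)$ if $x\in E,a=0$, else $0$; $\hat g(x,a)=g(x)$ if $x\in E,a=1$, else $0$. $\hat H_n$: histories $\hat h_n=(x_0,a_0,t_1,x_1,\dots,a_{n-1},t_n,x_n)$ with $a_m\in A(x_m)$. A deterministic policy $\pi=\{d_n\}$ consists of measurable $d_n:\mathbb{R}\times\hat H_n\to A$ with $d_n(s,\hat h_n)\in A(x_n)$; on $\hat\Omega=(\hat E\times A\times\mathbb{R}_+)^\infty$ with coordinates $\hat X_n,A_n,\hat T_{n+1}$, $\hat T_0=0$, $\hat S_n=\sum_{m\le n}\hat T_m$, $\hat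 Y_n=(\hat X_0,A_0,\hat T_1,\dots,\hat T_n,\hat X_n)$, $\hat{\mathbb{P}}^\pi_{(s,x)}$ is the unique probability with $\hat X_0=x$, $\hat T_0=0$ a.s., $A_n=d_n(s-\hat S_n,\hat Y_n)$ a.s., and $\hat{\mathbb{P}}^\pi_{(s,x)}(\hat T_{n+1}\le t,\hat X_{n+1}\in B\mid\hat Y_n,A_n)=\hat Q_T(t,B\mid\hat X_n,A_n)$; $\hat X(t)=\hat X_n$, $A(t)=A_n$ for $\hat S_n\le t<\hat S_{n+1}$; $U^\pi(s,x)=\hat{\mathbb{E}}^\pi_{(s,x)}\big[\int_0^s\hat c(\hat X(t),A(t))\,dt+\hat g(\hat X(s),A(s))\big]$. $H^0_n=E\times(\{0\}\times\mathbb{R}_+\times E)^n\subset\hat H_n$. Induced policy of a stopping time $\tau$: $B^\tau_n=\{Y_n(\omega):\omega\in\{\tau=n\}\}$; $d^\tau_n(s,\hat h_n)=\mathbf{1}_{B^\tau_n}(x_0,t_1,x_1,\dots,t_n,x_n)\mathbf{1}_{(0,\infty)}(s)$ if $\hat h_n\in H^0_n$, and $1$ if $\hat h_n\in\hat H_n\setminus H^0_n$. Induced stopping time of a deterministic policy $\pi=\{d_n\}$ and $s\in\mathbb{R}$: with $Y^0_n=(X_0,0,T_1,X_1,\dots,0,T_n,X_n)$, $\tau^s_\pi(\omega)=\inf\{n\in\mathbb{N}:d_n(s-S_n(\omega),Y^0_n(\omega))=1\}$, $\inf\emptyset=+\infty$. *)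

(* Defs.v *)
From HB Require Import structures.
From mathcomp Require Import all_boot all_order all_algebra.
From mathcomp Require Import all_classical all_reals all_analysis.
Set Implicit Arguments. Unset Strict Implicit. Unset Printing Implicit Defensive.
Import Order.TTheory GRing.Theory Num.Theory.
Local Open Scope classical_set_scope.
Local Open Scope ring_scope.

Section SMP.
Context {R : realType} {d : measure_display} {E : measurableType d}.

Definition borel_space : Prop :=
  exists (A : set R) (f : E -> R) (g : R -> E),
    measurable A /\ measurable_fun setT f /\ measurable_fun A g /\
    (forall x, A (f x)) /\ (forall x, g (f x) = x) /\ (forall r, A r -> f (g r) = r).

(* The semi-Markov kernel is represented by the probability kernel
   x |-> Q(dt, dy | x) on R x E;  Q(t,B|x) is its distribution function. *)
Definition Qdf (Q : R.-pker E ~> (R * E)%type) (t : R) (B : set E) (x : E)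
  : \bar R := Q x ([set u | u <= t] `*` B).

(* Q(0,B|x) = 0 (in particular the kernel lives on (0,oo) x E). *)
Definition semi_markov (Q : R.-pker E ~> (R * E)%type) : Prop :=
  forall x B, measurable B -> Qdf Q 0 B x = 0%E.

(* omega n = (t_n, x_n); the coordinate t_0 is a dummy (T_0 := 0). *)
Definition path := (nat -> R * E)%type.
HB.instance Definition _ := gen_eqMixin path.
HB.instance Definition _ := gen_choiceMixin path.
HB.instance Definition _ := isPointed.Build path (fun _ => (0%R, point)).
Definition X (n : nat) (w : path) : E := (w n).2.
Definition T (n : nat) (w : path) : R :=
  if n is k.+1 then (w k.+1).1 else 0.
Definition S (n : nat) (w : path) : R := \sum_(k < n.+1) T k w.

Definition cyl (n : nat) : set (set path) :=
  [set A | exists k, (k <= n)%N /\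
     ((exists B : set E, measurable B /\ A = X k @^-1` B) \/
      (exists I : set R, measurable I /\ A = T k @^-1` I))].

Definition Omega := g_sigma_algebraType (\bigcup_n cyl n).

Definition Fn (n : nat) : set (set Omega) := <<s cyl n >>.

(* stopping times; None stands for +oo *)
Definition stopping_time (tau : Omega -> option nat) : Prop :=
  forall n, Fn n [set w | tau w = Some n].

Definition smp_law (Q : R.-pker E ~> (R * E)%type) (x : E)
    (P : probability Omega R) : Prop :=
  {ae P, forall w : Omega, X 0 w = x} /\
  forall (n : nat) (C : set Omega) (t : R) (B : set E),
    Fn n C -> 0 <= t -> measurable B ->
    P (C `&` [set w | T n.+1 w <= t /\ B (X n.+1 w)]) =
    (\int[P]_(w in C) Qdf Q t B (X n w))%E.

Definition seg_index (Sq : nat -> R) (t : R) : option nat :=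
  match pselect (exists n, (fun n => (Sq n <= t) && (t < Sq n.+1)) n) with
  | left h => Some (ex_minn h)
  | right _ => None
  end.

(* X(t); None where the process is undefined (t >= S_oo) *)
Definition Xt (w : Omega) (t : R) : option E :=
  omap (fun n => X n w) (seg_index (fun n => S n w) t).

Definition Stau (tau : Omega -> option nat) (w : Omega) : \bar R :=
  match tau w with
  | Some n => (S n w)%:E
  | None => limn (fun n => (S n w)%:E)
  end.

Definition cost_int (f : E -> R) (w : Omega) (u : R) : \bar R :=
  (\int[lebesgue_measure]_(t in `[0%R, u]) (oapp f 0 (Xt w t))%:E)%E.

Definition reward (c g : E -> R) (s : R) (tau : Omega -> option nat)
    (w : Omega) : \bar R :=
  if (Stau tau w < s%:E)%E
  then (cost_int c w (fine (Stau tau w)) + (oapp g 0 (Xt w (fine (Stau tau w))))%:E)%E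
  else cost_int c w s.

Definition Vtau (P : E -> probability Omega R) (c g : E -> R)
    (tau : Omega -> option nat) (s : R) (x : E) : \bar R :=
  (\int[P x]_w reward c g s tau w)%E.

(* hat E = option E (None = Delta);  A = bool (false = 0 continue, true = 1 stop) *)
(* histories hat h_n = (x_0, [(a_0,t_1,x_1); ...; (a_{n-1},t_n,x_n)]) *)
Definition hist := (option E * seq (bool * R * option E))%type.

Definition policy := nat -> R -> hist -> bool.

(* hat omega n = (hat X_n, A_n, hat T_{n+1}) *)
Definition pathh := (nat -> option E * bool * R)%type.
HB.instance Definition _ := gen_eqMixin path.
HB.instance Definition _ := gen_choiceMixin path.
HB.instance Definition _ := gen_eqMixin pathh.
HB.instance Definition _ := gen_choiceMixin pathh.
HB.instance Definition _ := isPointed.Build pathh (fun _ => (None, false, 0%R)).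
Definition Xh (n : nat) (w : pathh) : option E := (w n).1.1.
Definition Ah (n : nat) (w : pathh) : bool := (w n).1.2.
Definition Th (n : nat) (w : pathh) : R :=
  if n is k.+1 then (w k).2 else 0.
Definition Sh (n : nat) (w : pathh) : R :=
  \sum_(k < n.+1) Th k w.
Definition Yh (n : nat) (w : pathh) : hist :=
  (Xh 0 w, [seq (Ah k w, Th k.+1 w, Xh k.+1 w) | k <- iota 0 n]).

Definition mopt (B : set (option E)) : Prop := measurable (Some @^-1` B).

Definition cylh (n : nat) : set (set pathh) :=
  [set A | exists k, (k <= n)%N /\
     ((exists B, mopt B /\ A = Xh k @^-1` B) \/
      (exists Ba : set bool, A = Ah k @^-1` Ba) \/
      (exists I : set R, measurable I /\ A = Th k @^-1` I))].

Definition Omegah := g_sigma_algebraType (\bigcup_n cylh n).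

Definition Fhn (n : nat) : set (set Omegah) := <<s cylh n >>.

(* hat Q_T(t, B | x, a); the pair (Delta, 0) is not admissible, we give it
   the same value as action 1 *)
Definition Qhat (Q : R.-pker E ~> (R * E)%type) (Tm : R) (t : R)
    (B : set (option E)) (x : option E) (a : bool) : \bar R :=
  match x, a with
  | Some y, false => Qdf Q t (Some @^-1` B) y
  | _, _ => if `[< (Tm + 1 <= t) /\ B None >] then 1%E else 0%E
  end.

Definition chat (c : E -> R) (x : option E) (a : bool) : R :=
  match x, a with Some y, false => c y | _, _ => 0 end.
Definition ghat (g : E -> R) (x : option E) (a : bool) : R :=
  match x, a with Some y, true => g y | _, _ => 0 end.

Definition smdp_law (Q : R.-pker E ~> (R * E)%type) (Tm : R) (pi : policy)
    (s : R) (x : E) (Ph : probability Omegah R) : Prop :=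
  {ae Ph, forall w : Omegah, Xh 0 w = Some x} /\
  (forall n, {ae Ph, forall w : Omegah, Ah n w = pi n (s - Sh n w) (Yh n w)}) /\
  forall (n : nat) (C : set Omegah) (t : R) (B : set (option E)),
    Fhn n C -> 0 <= t -> mopt B ->
    Ph (C `&` [set w | Th n.+1 w <= t /\ B (Xh n.+1 w)]) =
    (\int[Ph]_(w in C) Qhat Q Tm t B (Xh n w) (Ah n w))%E.

Definition chat_t (c : E -> R) (w : Omegah) (t : R) : R :=
  match seg_index (fun n => Sh n w) t with
  | Some n => chat c (Xh n w) (Ah n w) | None => 0 end.
Definition ghat_t (g : E -> R) (w : Omegah) (t : R) : R :=
  match seg_index (fun n => Sh n w) t with
  | Some n => ghat g (Xh n w) (Ah n w) | None => 0 end.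

Definition Upi (Ph : probability Omegah R) (c g : E -> R) (s : R) : \bar R :=
  (\int[Ph]_w ((\int[lebesgue_measure]_(t in `[0%R, s]) (chat_t c w t)%:E)
               + (ghat_t g w s)%:E))%E.

Definition Y (n : nat) (w : Omega) : E * seq (R * E) :=
  (X 0 w, [seq (T k.+1 w, X k.+1 w) | k <- iota 0 n]).

Definition Btau (tau : Omega -> option nat) (n : nat) : set (E * seq (R * E)) :=
  [set Y n w | w in [set w | tau w = Some n]].

Definition strip_step (p : bool * R * option E) : option (R * E) :=
  match p with (false, t, Some y) => Some (t, y) | _ => None end.

Definition h0_strip (n : nat) (h : hist) : option (E * seq (R * E)) :=
  match h.1 with
  | Some y0 =>
      if (size h.2 == n) && all (fun p => isSome (strip_step p)) h.2
      then Some (y0, pmap strip_step h.2) else None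
  | None => None
  end.

Definition induced_policy (tau : Omega -> option nat) : policy :=
  fun n s h => match h0_strip n h with
               | Some y => `[< Btau tau n y >] && (0 < s)
               | None => true
               end.

Definition Y0 (n : nat) (w : Omega) : hist :=
  (Some (X 0 w), [seq (false, T k.+1 w, Some (X k.+1 w)) | k <- iota 0 n]).

Definition induced_stop (pi : policy) (s : R) (w : Omega) : option nat :=
  match pselect (exists n, (fun n => pi n (s - S n w) (Y0 n w)) n) with
  | left h => Some (ex_minn h)
  | right _ => None
  end.

End SMP.

(* Main.v *)
(** Every path of the decision process is read back as a path of the
    semi-Markov process by forgetting the actions.  On the event that the
    controller has not stopped before step [n], the first [n] jumps under the
    policy induced by [tau] have the law of the first [n] jumps of the
    semi-Markov process restricted to the event that [tau] has not yet stopped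
    it before the horizon [s]: induction on [n], since action 0 uses the same
    kernel [Q].  Splitting the running cost over the intervals between jumps
    writes both rewards, almost surely, as the same series of nonnegative terms,
    each depending on finitely many jumps; so the expectations agree term by
    term.  Time after an explosion carries no cost on either side.  The stopping time induced by the policy
    agrees with [tau] on the event that [tau] stops before [s], and the series
    only sees that event. *)
From HB Require Import structures.
Require Import Defs.
From mathcomp Require Import all_boot all_order all_algebra.
From mathcomp Require Import all_classical all_reals all_analysis measurable_realfun.
Set Implicit Arguments.
Unset Strict Implicit.
Unset Printing Implicit Defensive.
Import Order.TTheory GRing.Theory Num.Theory.
Local Open Scope classical_set_scope.
Local Open Scope ring_scope.

(** * Integrals over jump intervals *)

Section AeEqual.
Import HBNNSimple.

(* Measurability is not required: the simple functions below [f] can be cut off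
   on the null set.  The rewards are thus never shown to be measurable. *)
Lemma ge0_ae_integral_eq {d} {T : measurableType d} {R : realType}
    (mu : {measure set T -> \bar R}) (f g : T -> \bar R) :
  (forall x, 0 <= f x)%E -> (forall x, 0 <= g x)%E ->
  {ae mu, forall x, f x = g x} ->
  (\int[mu]_x f x = \int[mu]_x g x)%E.
Proof.
wlog suff le_fg : f g / (forall x, 0 <= f x)%E -> (forall x, 0 <= g x)%E ->
    {ae mu, forall x, f x = g x} -> (\int[mu]_x f x <= \int[mu]_x g x)%E.
  move=> f0 g0 fg; apply/eqP; rewrite eq_le le_fg//= le_fg//.
  by apply: filterS fg => x ->.
move=> f0 g0 [N [mN N0 fgN]].
rewrite (ge0_integralTE mu f0) (ge0_integralTE mu g0).
apply: ge_ereal_sup => _ [h /= hf <-].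
have mNC : measurable (~` N) by exact: measurableC.
pose h' := proj_nnsfun h mNC.
have h'E x : h' x = if x \in ~` N then h x else 0 by rewrite /h' -mrestrict.
apply: ereal_sup_ubound; exists h'.
  move=> x; rewrite h'E; case: ifPn => // xN.
  have -> // : g x = f x.
  by rewrite inE in xN; apply: contrapT => fgx; apply: xN; apply: fgN => /esym.
rewrite -!integralT_nnsfun.
apply: ge0_ae_eq_integral.
all: try exact: measurableT.
all: try exact/measurable_EFinP/measurable_funPT.
- by move=> x _; rewrite lee_fin.
- by move=> x _; rewrite lee_fin.
- exists N; split => // x /= /not_implyP[_ hx].
  apply: contrapT => xN; apply: hx.
  by rewrite mindicE mem_set// mulr1.
Qed.

End AeEqual.

Section Segments.
Context {R : realType} (Sq : nat -> R).

Lemma seg_index_some t n : seg_index Sq t = Some n -> Sq n <= t < Sq n.+1.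
Proof.
rewrite /seg_index; case: pselect => // h [<-].
by case: ex_minnP.
Qed.

Hypothesis Sq_nd : forall n, Sq n <= Sq n.+1.

Let Sq_homo : {homo Sq : m n / (m <= n)%N >-> m <= n}.
Proof. exact/nondecreasing_seqP. Qed.

Lemma seg_uniq t m n : Sq m <= t < Sq m.+1 -> Sq n <= t < Sq n.+1 -> m = n.
Proof.
move=> /andP[m1 m2] /andP[n1 n2]; have [mn|nm|//] := ltngtP m n.
- by have := lt_le_trans m2 (le_trans (Sq_homo mn) n1); rewrite ltxx.
- by have := lt_le_trans n2 (le_trans (Sq_homo nm) m1); rewrite ltxx.
Qed.

Lemma seg_index_in t n : Sq n <= t < Sq n.+1 -> seg_index Sq t = Some n.
Proof.
move=> tn; rewrite /seg_index; case: pselect => [h|[]]; last by exists n.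
by congr Some; case: ex_minnP => m tm _; exact: (seg_uniq tm tn).
Qed.

Hypothesis Sq0 : Sq 0%N = 0.

(* The length of [[0, u] `&` [a, b[] when [0 <= a <= b]. *)
Definition overlap (u a b : R) : R := Num.min u b - Num.min u a.

Lemma overlap_ge0 u a b : a <= b -> 0 <= overlap u a b.
Proof. by move=> ab; rewrite subr_ge0 le_min !ge_min lexx ab orbT. Qed.

Lemma lebesgue_measure_overlap u a b : 0 <= a -> a <= b ->
  lebesgue_measure ([set` `[a, b[%R] `&` [set` `[0, u]%R]) = (overlap u a b)%:E.
Proof.
move=> a0 ab; rewrite /overlap.
have [ua|au] := ltP u a.
  rewrite (_ : _ `&` _ = set0); last first.
    apply/seteqP; split => // t /=; rewrite !in_itv/= => -[/andP[at_ _] /andP[_ tu]].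
    by have := le_lt_trans (le_trans at_ tu) ua; rewrite ltxx.
  rewrite measure0 min_l; last exact: le_trans (ltW ua) ab.
  by rewrite subrr.
have [ub|bu] := ltP u b.
  rewrite (_ : _ `&` _ = [set` `[a, u]%R]); last first.
    apply/seteqP; split => t /=; rewrite !in_itv/=.
      by move=> [/andP[-> _] /andP[_ ->]].
    move=> /andP[at_ tu]; rewrite at_ tu (le_lt_trans tu ub).
    by rewrite (le_trans a0 at_).
  rewrite lebesgue_measure_itv/= lte_fin; move: au; rewrite le_eqVlt => /orP[/eqP->|->]; last by rewrite EFinD EFinN.
  by rewrite ltxx subrr.
rewrite (_ : _ `&` _ = [set` `[a, b[%R]); last first.
  apply/seteqP; split => t /=; rewrite !in_itv/=.
    by move=> [/andP[-> ->]].
  move=> /andP[at_ tb]; rewrite at_ tb (le_trans a0 at_).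
  by rewrite (le_trans (ltW tb) bu).
rewrite lebesgue_measure_itv/= lte_fin; move: ab; rewrite le_eqVlt => /orP[/eqP->|->]; last by rewrite EFinD EFinN.
  by rewrite ltxx subrr.
Qed.

(** The integrand is a series of multiples of interval indicators with at most one nonzero term at
    each time; monotone convergence exchanges it with the integral. A time in no interval, such as
    one past the limit of [Sq], gets the default 0. *)
Lemma integral_segments (a : nat -> R) (u : R) : (forall n, 0 <= a n) ->
  (\int[lebesgue_measure]_(t in [set` `[0, u]%R]) (oapp a 0 (seg_index Sq t))%:E =
   \sum_(0 <= n <oo) (a n * overlap u (Sq n) (Sq n.+1))%:E)%E.
Proof.
move=> a0.
pose f n t : \bar R := ((a n)%:E * (\1_([set` `[Sq n, Sq n.+1[%R]) t)%:E)%E.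
have f0 n t : (0 <= f n t)%E by rewrite mule_ge0// lee_fin.
transitivity (\int[lebesgue_measure]_(t in [set` `[0, u]%R])
    (\sum_(0 <= n <oo) f n t))%E.
  apply: eq_integral => t _; case E : (seg_index Sq t) => [m|] /=.
    have tm := seg_index_some E.
    rewrite (nneseriesD1 (n := m))// eseries0 ?adde0.
      by rewrite /f indicE mem_set ?mule1//= in_itv.
    move=> i _ /= im; rewrite /f indicE memNset ?mule0//= in_itv/= => ti.
    by move: im; rewrite (seg_uniq ti tm) eqxx.
  rewrite eseries0// => i _ _; rewrite /f indicE memNset ?mule0//= in_itv/= => ti.
  by rewrite (seg_index_in ti) in E.
have mf n : measurable_fun setT (f n).
  apply: emeasurable_funM; first exact: measurable_cst.
  by apply/measurable_EFinP; exact: measurable_indic.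
rewrite integral_nneseries//; last first.
  by move=> n; apply: (measurable_funS measurableT) => //; exact: mf.
apply: eq_eseriesr => n _.
rewrite ge0_integralZl_EFin//; last first.
  by apply/measurable_EFinP; apply: measurable_indic.
rewrite integral_indic// EFinM; congr (_ * _)%E.
by apply: lebesgue_measure_overlap => //; rewrite -Sq0; exact: Sq_homo.
Qed.

(** An interval before index [n] ends by [u <= s], so both horizons keep its full length; a later
    one starts no earlier than [u] and contributes nothing. Writing the terms with [s] leaves the
    stopping index only in the test [k < n]. *)
Lemma integral_segments_stop (a : nat -> R) (u s : R) (n : nat) :
  (forall n, 0 <= a n) -> u = Sq n -> u <= s ->
  (\int[lebesgue_measure]_(t in [set` `[0, u]%R]) (oapp a 0 (seg_index Sq t))%:E =
   \sum_(0 <= k <oo) (if (k < n)%N then a k * overlap s (Sq k) (Sq k.+1) else 0)%:E)%E.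
Proof.
move=> a0 un us; rewrite integral_segments//; apply: eq_eseriesr => k _; congr EFin.
rewrite /overlap; case: ltnP => kn.
  by congr (_ * _); rewrite !min_r// ?(le_trans _ us)// un; apply: Sq_homo => //; exact: ltnW.
have nk := Sq_homo kn; have nk1 := Sq_homo (leqW kn).
by rewrite !min_l ?un ?subrr ?mulr0.
Qed.

(** The limit of a nondecreasing sequence is its supremum. It lies between the reals [Sq 0] and [s],
    so [fine] does not distort it. *)
Lemma seg_le_lim (s : R) n : (limn (fun n => (Sq n)%:E) < s%:E)%E ->
  Sq n <= fine (limn (fun n => (Sq n)%:E)) <= s.
Proof.
move=> Ss.
have Sl k : ((Sq k)%:E <= limn (fun n => (Sq n)%:E))%E.
  have nd : nondecreasing_seq (fun n => (Sq n)%:E).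
    by move=> m p mp; rewrite lee_fin; exact: Sq_homo.
  rewrite (cvg_lim _ (ereal_nondecreasing_cvgn nd))//.
  by apply: ereal_sup_ubound; exists k.
rewrite -!lee_fin fineK ?Sl ?(ltW Ss)// fin_numE; apply/andP; split.
  by rewrite gt_eqF// (lt_le_trans _ (Sl 0%N))// ltNyr.
by rewrite lt_eqF// (lt_le_trans Ss)// leey.
Qed.

(** Every interval ends by the limit, which is below [s], so neither horizon cuts any interval. *)
Lemma integral_segments_lim (a : nat -> R) (s : R) :
  (forall n, 0 <= a n) -> (limn (fun n => (Sq n)%:E) < s%:E)%E ->
  (\int[lebesgue_measure]_(t in [set` `[0, fine (limn (fun n => (Sq n)%:E))]%R])
     (oapp a 0 (seg_index Sq t))%:E =
   \sum_(0 <= k <oo) (a k * overlap s (Sq k) (Sq k.+1))%:E)%E.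
Proof.
move=> a0 Ss; rewrite integral_segments//; apply: eq_eseriesr => k _; congr EFin.
have Sl n := andP (seg_le_lim n Ss).
by rewrite /overlap !min_r// ?(Sl _).1// (le_trans (Sl _).1 (Sl 0%N).2).
Qed.

End Segments.

(** * Filtrations and histories *)

(** The sets with measurable preimage form a sigma-algebra, so testing generators is enough. *)
Lemma sigma_preimage {T U : Type} (f : T -> U) (G : set (set T)) (H : set (set U)) :
  (forall B, H B -> <<s G >> (f @^-1` B)) ->
  forall B, <<s H >> B -> <<s G >> (f @^-1` B).
Proof.
move=> HG; apply: smallest_sub; last exact: HG.
split=> [|A GA|A GA].
- by rewrite /= preimage_set0; exact: sigma_algebra0.
- by rewrite /= setTD preimage_setC -setTD; exact: sigma_algebraCD.
- by rewrite /= preimage_bigcup; exact: sigma_algebra_bigcup.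
Qed.

Lemma pmap_map_some {I : eqType} {A B : Type} (h : A -> option B) (f : I -> A)
    (f' : I -> B) (s : seq I) :
  {in s, forall i, h (f i) = Some (f' i)} -> pmap h (map f s) = map f' s.
Proof.
elim: s => //= i s IH hf; rewrite hf ?mem_head//= IH// => j js.
by apply: hf; rewrite in_cons js orbT.
Qed.

Section Filtration.
Context {R : realType} {d : measure_display} {E : measurableType d}.
Local Notation path := (@Defs.path R d E).
Local Notation pathh := (@Defs.pathh R d E).

(** The path space with only the information of the first [n] steps, so that [Fn n]-measurability of
    a function is an ordinary [measurable_fun]. *)
Definition OmegaN n := g_sigma_algebraType (@cyl R d E n).
Definition OmegahN n := g_sigma_algebraType (@cylh R d E n).

Lemma Fn_Omega n (A : set path) : Fn n A -> measurable (A : set (@Omega R d E)).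
Proof.
apply: sub_sigma_algebra2 => B cB; by exists n.
Qed.

Lemma Fn_le m n (A : set path) : (m <= n)%N -> Fn m A -> Fn n A.
Proof.
move=> mn; apply: sub_sigma_algebra2 => B [k [km cB]]; exists k; split => //.
exact: leq_trans mn.
Qed.

Lemma Fhn_Omegah n (A : set pathh) : Fhn n A -> measurable (A : set (@Omegah R d E)).
Proof.
apply: sub_sigma_algebra2 => B cB; by exists n.
Qed.

Lemma Fhn_le m n (A : set pathh) : (m <= n)%N -> Fhn m A -> Fhn n A.
Proof.
move=> mn; apply: sub_sigma_algebra2 => B [k [km cB]]; exists k; split => //.
exact: leq_trans mn.
Qed.

Lemma FnI n (A B : set path) : Fn n A -> Fn n B -> Fn n (A `&` B).
Proof. exact: (@measurableI _ (OmegaN n)). Qed.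

Lemma FnC n (A : set path) : Fn n A -> Fn n (~` A).
Proof. exact: (@measurableC _ (OmegaN n)). Qed.

Lemma FhnI n (A B : set pathh) : Fhn n A -> Fhn n B -> Fhn n (A `&` B).
Proof. exact: (@measurableI _ (OmegahN n)). Qed.

Lemma Fn_T n k (B : set R) : (k <= n)%N -> measurable B -> Fn n (@T R d E k @^-1` B).
Proof.
move=> kn mB; apply: sub_sigma_algebra; exists k; split => //; right; by exists B.
Qed.

Lemma Fn_X n k (B : set E) : (k <= n)%N -> measurable B -> Fn n (@X R d E k @^-1` B).
Proof.
move=> kn mB; apply: sub_sigma_algebra; exists k; split => //; left; by exists B.
Qed.

Lemma Fhn_Th n k (B : set R) : (k <= n)%N -> measurable B -> Fhn n (@Th R d E k @^-1` B).
Proof.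
move=> kn mB; apply: sub_sigma_algebra; exists k; split => //; right; right; by exists B.
Qed.

Lemma Fhn_Xh n k (B : set (option E)) : (k <= n)%N -> mopt B ->
  Fhn n (@Xh R d E k @^-1` B).
Proof.
move=> kn mB; apply: sub_sigma_algebra; exists k; split => //; left; by exists B.
Qed.

Lemma Fhn_Ah n k (B : set bool) : (k <= n)%N -> Fhn n (@Ah R d E k @^-1` B).
Proof.
move=> kn; apply: sub_sigma_algebra; exists k; split => //; right; left; by exists B.
Qed.

Lemma measurable_T n k : (k <= n)%N -> measurable_fun setT (@T R d E k : OmegaN n -> R).
Proof. by move=> kn _ B mB; rewrite setTI; exact: Fn_T. Qed.

Lemma measurable_X n k : (k <= n)%N -> measurable_fun setT (@X R d E k : OmegaN n -> E).
Proof. by move=> kn _ B mB; rewrite setTI; exact: Fn_X. Qed.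

Lemma measurable_S n k : (k <= n)%N -> measurable_fun setT (@S R d E k : OmegaN n -> R).
Proof.
move=> kn; apply: measurable_sum => -[i /= ik]; apply: measurable_T.
by rewrite (leq_trans _ kn).
Qed.

Definition agree n (w w' : path) :=
  forall k, (k <= n)%N -> T k w = T k w' /\ X k w = X k w'.

(** Good-set argument: invariance under [agree n] holds for the generators and passes to
    complements, by exchanging the two paths, and to countable unions. *)
Lemma Fn_agree n (A : set path) w w' : Fn n A -> agree n w w' -> A w -> A w'.
Proof.
suff : Fn n `<=` [set A : set path | forall w w', agree n w w' -> A w -> A w'].
  by move=> h /h; exact.
apply: smallest_sub.
  split=> [//|B hB w1 w2 w12 [_ Bw1]|B hB w1 w2 w12 [i _ Bi]].
  - split=> //; apply: contra_not Bw1; apply: hB => k kn.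
    by have [-> ->] := w12 k kn.
  - by exists i => //; exact: hB Bi.
move=> B [k [kn [[C [mC ->]]|[C [mC ->]]]]] w1 w2 w12 /=;
  by have [ET EX] := w12 k kn; rewrite ?ET ?EX.
Qed.

Lemma Y_agree n (w w' : path) : Y n w = Y n w' -> agree n w w'.
Proof.
case=> X0 /eq_in_map XT [|k] kn; first by split.
by have := XT k; rewrite mem_iota add0n => /(_ kn)[].
Qed.

(** A history in [Btau tau n] may come from another path, but that path agrees with [w] up to step
    [n], and an event of [Fn n] cannot separate the two. *)
Lemma Btau_Y (tau : @Omega R d E -> option nat) n (w : path) :
  stopping_time tau -> Btau tau n (Y n w) <-> tau w = Some n.
Proof.
move=> st; split=> [[w' /= tw' /Y_agree ww']|tw]; last by exists w.
exact: (Fn_agree (st n) ww').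
Qed.

(* The default at [Delta] is never seen on the event [alive]. *)
Definition to_path (w : pathh) : path := fun k => (Th k w, odflt point (Xh k w)).

Lemma T_to_path k w : T k (to_path w) = Th k w.
Proof. by case: k. Qed.

Lemma S_to_path k w : S k (to_path w) = Sh k w.
Proof. by apply: eq_bigr => i _; rewrite T_to_path. Qed.

Lemma Fhn_to_path n (A : set path) : Fn n A -> Fhn n (to_path @^-1` A).
Proof.
apply: sigma_preimage => B [k [kn [[C [mC ->]]|[C [mC ->]]]]].
  exact: (@Fhn_Xh n k (odflt point @^-1` C)).
rewrite (_ : _ @^-1` _ = @Th R d E k @^-1` C); first exact: Fhn_Th.
by apply/seteqP; split => w /=; rewrite T_to_path.
Qed.

(** The event that [Yh n] lies in [H^0_n]; action [n] itself is left free. *)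
Definition alive n : set pathh :=
  [set w | (forall k, (k <= n)%N -> Xh k w != None) /\
           (forall k, (k < n)%N -> Ah k w = false)].

Lemma aliveS n : alive n.+1 =
  (alive n `&` Ah n @^-1` [set false]) `&` Xh n.+1 @^-1` [set~ None].
Proof.
apply/seteqP; split=> w /=.
  move=> [hX hA]; split; last by apply/eqP; exact: hX.
  split; last exact: hA.
  by split=> k kn; [apply: hX; exact: leqW|apply: hA; exact: leqW].
move=> [[[hX hA] An] /eqP Xn]; split=> k.
  by rewrite leq_eqVlt => /orP[/eqP->//|]; exact: hX.
by rewrite ltnS leq_eqVlt => /orP[/eqP->//|]; exact: hA.
Qed.

Lemma Fhn_alive n : Fhn n (alive n).
Proof.
have mN : mopt [set~ None : option E].
  rewrite /mopt (_ : _ @^-1` _ = setT)//; exact/seteqP.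
elim: n => [|n IH].
  rewrite (_ : alive 0 = Xh 0 @^-1` [set~ None]); first exact: Fhn_Xh.
  apply/seteqP; split=> w /=.
    by move=> [h _]; apply/eqP; exact: h.
  by move=> /eqP h; split=> // k; rewrite leqn0 => /eqP->.
rewrite aliveS; apply: FhnI; last exact: Fhn_Xh.
apply: (@Fhn_le n) => //; apply: FhnI => //; exact: Fhn_Ah.
Qed.

Lemma h0_strip_alive n w : alive n w -> h0_strip n (Yh n w) = Some (Y n (to_path w)).
Proof.
move=> [hX hA]; rewrite /h0_strip /Yh /Y /=.
rewrite /X /to_path /=.
have := hX 0%N isT; case X0 : (Xh 0 w) => [y|//] _.
rewrite size_map size_iota eqxx /= all_map.
have stripE k : (k < n)%N -> strip_step (Ah k w, Th k.+1 w, Xh k.+1 w) =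
    Some (Th k.+1 w, odflt point (Xh k.+1 w)).
  by move=> kn; rewrite /= hA//; have := hX k.+1 kn; case: Xh.
rewrite (_ : all _ _); last first.
  by apply/allP => k; rewrite mem_iota add0n => /stripE /= ->.
congr (Some (_, _)); apply: pmap_map_some => k.
by rewrite mem_iota add0n; exact: stripE.
Qed.

Lemma h0_strip_None n w : ~ alive n w -> h0_strip n (Yh n w) = None.
Proof.
apply: contra_notP => /eqP; rewrite /h0_strip /Yh /=.
case X0 : (Xh 0 w) => [y|//]; rewrite size_map size_iota eqxx/= all_map.
case: ifPn => // /allP h _.
have {}h k : (k < n)%N -> Ah k w = false /\ Xh k.+1 w != None.
  move=> kn; have /= := h k; rewrite mem_iota add0n kn => /(_ isT).
  by case: Ah => //; case: Xh.
split=> [[|k] kn|k kn]; first by rewrite X0.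
- by have [] := h k kn.
- by have [] := h k kn.
Qed.

End Filtration.

(** * Measures agreeing on a sub-sigma-algebra *)

Section ImageOfRestriction.
Context {d1 d2 : measure_display} {T1 : measurableType d1} {T2 : measurableType d2}
  {R : realType}.
Variables (mu : {measure set T1 -> \bar R}) (f : T1 -> T2) (D : set T1).
Hypotheses (mf : measurable_fun setT f) (mD : measurable D).

(** The image under [f] of [mu] restricted to [D]. The measurability proofs are arguments so that
    the measure instance can be attached to the applied term. *)
Definition image_restr of measurable_fun setT f & measurable D :=
  fun A : set T2 => mu (D `&` f @^-1` A).

Local Notation nu := (image_restr mf mD).

Let mpre A : measurable A -> measurable (D `&` f @^-1` A).
Proof. by move=> mA; rewrite -[f @^-1` A]setTI; apply: measurableI => //; exact: mf. Qed.

Let nu0 : nu set0 = 0%E.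
Proof. by rewrite /image_restr preimage_set0 setI0 measure0. Qed.

Let nu_ge0 A : (0 <= nu A)%E.
Proof. exact: measure_ge0. Qed.

Let nu_sigma_additive : semi_sigma_additive nu.
Proof.
move=> F mF tF mUF; rewrite /image_restr preimage_bigcup setI_bigcupr.
apply: measure_semi_sigma_additive.
- by move=> n; exact: mpre.
- apply/trivIsetP => /= i j _ _ ij; rewrite setIACA setIid -preimage_setI.
  by move/trivIsetP : tF => /(_ _ _ _ _ ij) ->//; rewrite preimage_set0 setI0.
- by rewrite -setI_bigcupr -preimage_bigcup; exact: mpre.
Qed.

HB.instance Definition _ := isMeasure.Build _ _ _ nu nu0 nu_ge0 nu_sigma_additive.

(** Change of variables: the complement of [D] is null for the restriction of [mu], so the integral
    over [D] is one over the whole space for that restriction. *)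
Lemma ge0_integral_image_restr (h : T2 -> \bar R) :
  measurable_fun setT h -> (forall y, 0 <= h y)%E ->
  (\int[nu]_y h y = \int[mu]_(x in D) h (f x))%E.
Proof.
move=> mh h0.
have -> : (\int[mu]_(x in D) h (f x) = \int[mrestr mu mD]_(x in D) h (f x))%E.
  by apply: eq_measure_integral => A mA AD; rewrite /= /mrestr setIidl.
have -> : (\int[mrestr mu mD]_(x in D) h (f x) = \int[mrestr mu mD]_x h (f x))%E.
  rewrite integral_mkcond; apply: ge0_ae_integral_eq => //.
    by move=> x; exact: erestrict_ge0.
  exists (~` D); split; first exact: measurableC.
    by rewrite /= /mrestr setICl measure0.
  by move=> x /=; apply: contra_not => Dx; rewrite patchE mem_set.
rewrite -(ge0_integral_pushforward mf (mrestr mu mD) measurableT mh)//.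
apply: eq_measure_integral => A mA _.
by rewrite /= /pushforward /mrestr /image_restr setIC.
Qed.

End ImageOfRestriction.

Section RestrictedImages.
Context {d d1 d2 : measure_display} {U : measurableType d}
  {T1 : measurableType d1} {T2 : measurableType d2} {R : realType}.
Variables (mu1 : {measure set T1 -> \bar R}) (mu2 : {measure set T2 -> \bar R})
  (f1 : T1 -> U) (f2 : T2 -> U) (D1 : set T1) (D2 : set T2).
Hypotheses (mf1 : measurable_fun setT f1) (mf2 : measurable_fun setT f2)
  (mD1 : measurable D1) (mD2 : measurable D2).

Lemma eq_image_restr_integral (h : U -> \bar R) :
  (forall A, measurable A -> mu1 (D1 `&` f1 @^-1` A) = mu2 (D2 `&` f2 @^-1` A)) ->
  measurable_fun setT h -> (forall y, 0 <= h y)%E ->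
  (\int[mu1]_(x in D1) h (f1 x) = \int[mu2]_(x in D2) h (f2 x))%E.
Proof.
move=> mu12 mh h0.
rewrite -(ge0_integral_image_restr mu1 mf1 mD1)//.
rewrite -(ge0_integral_image_restr mu2 mf2 mD2)//.
by apply: eq_measure_integral => A mA _; exact: mu12.
Qed.

(** Uniqueness of measures on a pi-system, applied to the two restricted images; finiteness of
    [mu1 D1] bounds the mass of every set of the cover [g]. *)
Lemma eq_image_restr (G : set (set U)) (g : nat -> set U) :
  G `<=` measurable -> (forall i, G (g i)) -> \bigcup_k g k = setT -> setI_closed G ->
  (mu1 D1 < +oo)%E ->
  (forall A, G A -> mu1 (D1 `&` f1 @^-1` A) = mu2 (D2 `&` f2 @^-1` A)) ->
  forall A, <<s G >> A -> mu1 (D1 `&` f1 @^-1` A) = mu2 (D2 `&` f2 @^-1` A).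
Proof.
move=> Gm Gg gT GI fin mu12 A GA.
rewrite -[LHS]/(image_restr mu1 mf1 mD1 A) -[RHS]/(image_restr mu2 mf2 mD2 A).
apply: (g_sigma_algebra_measure_unique G Gm g Gg gT (image_restr mu1 mf1 mD1)
  (image_restr mu2 mf2 mD2) GI) => // k.
apply: le_lt_trans fin; apply: le_measure; rewrite ?inE//.
apply: measurableI => //; rewrite -[X in measurable X]setTI; apply: mf1 => //.
exact: Gm.
Qed.

End RestrictedImages.

Lemma ae_eq_measure {d} {T : measurableType d} {R : realType}
    (mu : {measure set T -> \bar R}) (A B : set T) :
  measurable A -> measurable B -> {ae mu, forall x, A x <-> B x} -> mu A = mu B.
Proof.
move=> mA mB AB; rewrite -(setIT A) -(setIT B) -!integral_indic//.
apply: ge0_ae_integral_eq; [by move=> x; rewrite lee_fin..|].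
apply: filterS AB => x AB; rewrite !indicE; congr (_%:R)%:E; congr nat_of_bool.
by apply/idP/idP; rewrite !inE => /AB.
Qed.

Lemma measure0_aeP {d} {T : measurableType d} {R : realType}
    (mu : {measure set T -> \bar R}) (A : set T) (p : T -> Prop) :
  measurable A -> mu A = 0%E -> (forall x, ~ A x -> p x) -> {ae mu, forall x, p x}.
Proof.
move=> mA A0 Ap; exists A; split => // x /=.
by apply: contra_notP; exact: Ap.
Qed.

(** * Induced policies and induced stopping times *)

Section Stopping.
Context {R : realType} {d : measure_display} {E : measurableType d}.
Local Notation path := (@Defs.path R d E).
Local Notation pathh := (@Defs.pathh R d E).
Variables (tau : @Omega R d E -> option nat) (s : R).
Hypothesis st : stopping_time tau.

(** Only stops strictly before the horizon count: these are the ones that earn [g] and that make the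
    induced policy choose action 1. *)
Definition stops n : set path := [set w | tau w = Some n /\ S n w < s].

(** Paths on which [tau] has occurred at or after time [s] still belong here: the induced policy
    goes on with action 0 on them. *)
Definition running n : set path := [set w | forall k, (k < n)%N -> ~ stops k w].

Lemma Fn_stops n : Fn n (stops n).
Proof.
apply: FnI; first exact: st.
have := @measurable_S R d E n n (leqnn n) measurableT _ (measurable_itv `]-oo, s[).
rewrite setTI; congr (_ _); apply/seteqP; split => w /=; by rewrite in_itv.
Qed.

Lemma runningS n : running n.+1 = running n `&` ~` stops n.
Proof.
apply/seteqP; split=> w /=; first by move=> h; split=> [k kn|]; apply: h => //; exact: leqW.
by move=> [h hn] k; rewrite ltnS leq_eqVlt => /orP[/eqP->//|]; exact: h.
Qed.

Lemma running0 : running 0 = setT.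
Proof. by apply/seteqP; split. Qed.

Lemma Fn_running n : Fn n (running n).
Proof.
elim: n => [|n IH].
  by rewrite running0; exact: (@measurableT _ (OmegaN 0)).
rewrite runningS; apply: (@Fn_le _ _ _ n) => //.
by apply: FnI => //; apply: FnC; exact: Fn_stops.
Qed.

Lemma stops_uniq m n w : stops m w -> stops n w -> m = n.
Proof. by move=> [tm _] [+ _]; rewrite tm => -[]. Qed.

Lemma stops_running n w : stops n w -> running n w.
Proof. by move=> sn k kn sk; move: kn; rewrite (stops_uniq sk sn) ltnn. Qed.

Lemma induced_policy_alive n (w : pathh) : alive n w ->
  induced_policy tau n (s - Sh n w) (Yh n w) = `[< stops n (to_path w) >].
Proof.
move=> aw; rewrite /induced_policy h0_strip_alive// subr_gt0.
apply/andP/asboolP => [[/asboolP/(Btau_Y _ _ st) tw Ss]|[tw Ss]].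
  by split=> //; rewrite S_to_path.
by rewrite S_to_path in Ss; split=> //; apply/asboolP/Btau_Y.
Qed.

Lemma induced_policy_dead n (u : R) (w : pathh) : ~ alive n w ->
  induced_policy tau n u (Yh n w) = true.
Proof. by move=> aw; rewrite /induced_policy h0_strip_None. Qed.

(** Turns [Y0 n w] into the history of a decision path that never stops, so the results on [alive]
    histories cover the induced stopping time. *)
Definition lift_path (w : path) : pathh := fun k => (Some (X k w), false, T k.+1 w).

Lemma alive_lift n w : alive n (lift_path w).
Proof. by []. Qed.

(** Agreement rather than equality: the dummy time in coordinate 0 is reset to 0, which [T] does not
    see. *)
Lemma agree_lift n w : agree n w (to_path (lift_path w)).
Proof. by move=> k kn; rewrite T_to_path; split => //; case: k kn. Qed.

Lemma induced_policy_Y0 n (w : path) :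
  induced_policy tau n (s - S n w) (Y0 n w) = `[< stops n w >].
Proof.
have ag := @agree_lift n w.
have SE : S n w = Sh n (lift_path w).
  by rewrite -S_to_path; apply: eq_bigr => i _; have [] := ag i (ltn_ord i).
rewrite SE -[Y0 n w]/(Yh n (lift_path w)) (induced_policy_alive (alive_lift n w)).
apply/asbool_equiv_eq; split; last exact: (Fn_agree (@Fn_stops n) ag).
by apply: (Fn_agree (@Fn_stops n)) => k kn; have [-> ->] := ag k kn.
Qed.

(** At most one index stops, so the first one is the only one. *)
Lemma induced_stop_stops n (w : path) :
  induced_stop (induced_policy tau) s w = Some n <-> stops n w.
Proof.
rewrite /induced_stop; case: pselect => [h|h]; last first.
  split=> // sn; exfalso; apply: h; exists n.
  by rewrite induced_policy_Y0; exact/asboolP.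
case: ex_minnP => m; rewrite induced_policy_Y0 => /asboolP sm _.
by split=> [[<-]//|sn]; rewrite (stops_uniq sm sn).
Qed.

End Stopping.

(** * Laws of the two processes *)

Section Laws.
Context {R : realType} {d : measure_display} {E : measurableType d}.
Local Notation path := (@Defs.path R d E).
Local Notation pathh := (@Defs.pathh R d E).
Variables (Q : R.-pker E ~> (R * E)%type) (Tm s : R) (x : E)
  (tau : @Omega R d E -> option nat)
  (P : probability (@Omega R d E) R) (Ph : probability (@Omegah R d E) R).
Hypotheses (sQ : semi_markov Q) (Tm0 : 0 <= Tm) (st : stopping_time tau)
  (lawP : smp_law Q x P) (lawPh : smdp_law Q Tm (induced_policy tau) s x Ph).

Local Notation to_path := (@to_path R d E).
Local Notation alive := (@alive R d E).

Lemma mopt_setT : mopt [set: option E].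
Proof. exact: measurableT. Qed.

Lemma measurable_Qdf t B : measurable B -> measurable_fun setT (Qdf Q t B).
Proof.
move=> mB; apply: measurable_kernel; apply: measurableX => //.
exact: (measurable_itv `]-oo, t]).
Qed.

Lemma measurable_le_jump (n : nat) (t : R) B : measurable B ->
  Fn n.+1 [set w : path | T n.+1 w <= t /\ B (X n.+1 w)].
Proof.
move=> mB; apply: FnI; last exact: (@Fn_X _ _ _ n.+1).
exact: (@Fn_T _ _ _ n.+1 n.+1 _ (leqnn _) (measurable_itv `]-oo, t])).
Qed.

(** The kernel has no mass at times up to 0, so the law at [t = 0] makes each event of a nonpositive
    jump time null. *)
Lemma T_gt0 : {ae P, forall w : @Omega R d E, forall n, 0 < T n.+1 w}.
Proof.
apply: ae_foralln => n.
apply: (measure0_aeP (T := @Omega R d E)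
  (A := setT `&` [set w : path | T n.+1 w <= 0 /\ setT (X n.+1 w)])).
- by rewrite setTI; apply: (@Fn_Omega _ _ _ n.+1); exact: measurable_le_jump.
- apply: etrans.
    by apply: (lawP.2 n) => //; exact: (@measurableT _ (OmegaN n)).
  by apply: integral0_eq => w _; exact: sQ.
- by move=> w /= h; rewrite ltNge; apply/negP => Tw; apply: h.
Qed.

Lemma measurable_le_jumph (n : nat) (t : R) (B : set (option E)) : mopt B ->
  Fhn n.+1 [set w : pathh | Th n.+1 w <= t /\ B (Xh n.+1 w)].
Proof.
move=> mB; apply: FhnI; last exact: (@Fhn_Xh _ _ _ n.+1).
exact: (@Fhn_Th _ _ _ n.+1 n.+1 _ (leqnn _) (measurable_itv `]-oo, t])).
Qed.

(** A jump to which the kernel gives probability zero everywhere on [C] almost surely does not occur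
    there. The support properties below follow by choosing [C], [t] and [B]. *)
Lemma ae_jump n (C : set pathh) t (B : set (option E)) (p : pathh -> Prop) :
  Fhn n C -> 0 <= t -> mopt B ->
  (forall w, C w -> Qhat Q Tm t B (Xh n w) (Ah n w) = 0%E) ->
  (forall w, ~ (C w /\ Th n.+1 w <= t /\ B (Xh n.+1 w)) -> p w) ->
  {ae Ph, forall w : @Omegah R d E, p w}.
Proof.
move=> FC t0 mB Q0 hp.
apply: (measure0_aeP (T := @Omegah R d E)
  (A := C `&` [set w : pathh | Th n.+1 w <= t /\ B (Xh n.+1 w)])) => //.
- apply: (@Fhn_Omegah _ _ _ n.+1); apply: FhnI; last exact: measurable_le_jumph.
  exact: (@Fhn_le _ _ _ n).
- by apply: (etrans (lawPh.2.2 n C t B FC t0 mB)); exact: integral0_eq.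
Qed.

Lemma Th_gt0 : {ae Ph, forall w : @Omegah R d E, forall n, 0 < Th n.+1 w}.
Proof.
apply: ae_foralln => n.
apply: (@ae_jump n setT 0 setT) => //.
- exact: (@measurableT _ (OmegahN n)).
- exact: mopt_setT.
- move=> w _; rewrite /Qhat; have TmF : ~ (Tm + 1 <= 0 /\ setT (@None E)).
    by case; rewrite leNgt ltr_wpDl.
  case: (Xh n w) => [y|]; case: (Ah n w); rewrite ?(asboolF TmF)//.
  apply: sQ; exact: measurableT.
- by move=> w h; rewrite ltNge; apply/negP => Tw; apply: h.
Qed.

(** The sojourn after action 1 lasts [Tm + 1], so the kernel has no mass at times up to [Tm]. This
    sojourn outlasts every horizon [s <= Tm]. *)
Lemma Th_stopped : {ae Ph, forall w : @Omegah R d E, forall n,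
  Ah n w -> Tm < Th n.+1 w}.
Proof.
apply: ae_foralln => n.
apply: (@ae_jump n (Ah n @^-1` [set true]) Tm setT) => //.
- exact: Fhn_Ah.
- exact: mopt_setT.
- move=> w /= ->; rewrite /Qhat; have TmF : ~ (Tm + 1 <= Tm /\ setT (@None E)).
    by case; rewrite gerDl ler10.
  by case: (Xh n w) => [y|]; rewrite ?(asboolF TmF).
- by move=> w h An; rewrite ltNge; apply/negP => Tw; apply: h.
Qed.

Lemma alive_next : {ae Ph, forall w : @Omegah R d E, forall n,
  alive n w -> Ah n w = false -> alive n.+1 w}.
Proof.
apply: ae_foralln => n.
(* The law only speaks of jumps within a bounded time, so the bound [m] runs through the integers;
   from a state of [E], action 0 gives [Delta] no mass. *)
have : {ae Ph, forall w : @Omegah R d E, forall m,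
    Th n.+1 w <= m%:R -> alive n w -> Ah n w = false -> alive n.+1 w}.
  apply: ae_foralln => m.
  apply: (@ae_jump n (alive n `&` Ah n @^-1` [set false]) m%:R [set None]) => //.
  - by apply: FhnI; [exact: Fhn_alive|exact: Fhn_Ah].
  - by rewrite /mopt (_ : _ @^-1` _ = set0)//; apply/seteqP; split.
  - move=> w [[hX _] /= ->]; have := hX n (leqnn n); case: (Xh n w) => //= y _.
    rewrite (_ : Some @^-1` _ = set0); last by apply/seteqP; split.
    by rewrite /Qdf setX0 measure0.
  - move=> w h Tw aw An; rewrite aliveS; split; first by split.
    by move=> Xw; apply: h; split; [split|].
apply: filterS => w h; apply: (h (Num.bound `|Th n.+1 w|)).
by rewrite (le_trans (ler_norm _))// ltW// archi_boundP.
Qed.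

Lemma action_alive : {ae Ph, forall w : @Omegah R d E, forall n,
  alive n w -> Ah n w = `[< stops tau s n (to_path w) >]}.
Proof.
apply: ae_foralln => n; have := lawPh.2.1 n; apply: filterS => w -> aw.
exact: induced_policy_alive.
Qed.

Lemma action_dead : {ae Ph, forall w : @Omegah R d E, forall n,
  ~ alive n w -> Ah n w = true}.
Proof.
apply: ae_foralln => n; have := lawPh.2.1 n; apply: filterS => w -> aw.
exact: induced_policy_dead.
Qed.

(* A pi-system generating [Fn n.+1]; real [t] of any sign are needed for that,
   although the laws only speak about [0 <= t]. *)
Definition jump_sets n : set (set path) := [set A | exists C t B,
  [/\ Fn n C, measurable B & A = C `&` [set w | T n.+1 w <= t /\ B (X n.+1 w)]]].

Lemma le_bigcup (n : nat) (A : set path) (B : set E) : A `&` X n @^-1` B =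
  \bigcup_m (A `&` [set w | T n w <= m%:R /\ B (X n w)]).
Proof.
apply/seteqP; split => w /=; last by move=> [m _ [Aw [_ Bw]]].
move=> [Aw Bw]; exists (Num.bound `|T n w|) => //; split=> //; split=> //.
by rewrite (le_trans (ler_norm _))// ltW// archi_boundP.
Qed.

(** Generators up to step [n] and those in [X n.+1] are unions over integer time bounds; for
    [T n.+1] open upper rays are enough, and their preimages are complements. *)
Lemma Fn_jump_sets n : Fn n.+1 `<=` <<s jump_sets n >>.
Proof.
have FT : Fn n [set: path] by exact: (@measurableT _ (OmegaN n)).
have js C t B : Fn n C -> measurable B ->
    <<s jump_sets n >> (C `&` [set w | T n.+1 w <= t /\ B (X n.+1 w)]).
  by move=> FC mB; apply: sub_sigma_algebra; exists C, t, B.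
apply: (sigma_preimage (f := id)) => A [k [kn1 cB]]; rewrite preimage_id.
have [kn|nk] := leqP k n.
  have FA : Fn n A.
    by apply: sub_sigma_algebra; exists k.
  rewrite -(setIT A) -(preimage_setT (@X R d E n.+1)) le_bigcup.
  by apply: sigma_algebra_bigcup => m; exact: js.
have kE : k = n.+1 by apply/eqP; rewrite eqn_leq kn1.
rewrite {k kn1 nk}kE in cB; case: cB => -[B [mB ->]].
  rewrite -(setTI (_ @^-1` _)) le_bigcup.
  by apply: sigma_algebra_bigcup => m; exact: js.
have {mB} : <<s @RGenOInfty.G R >> B by have := mB; rewrite [X in X B](RGenOInfty.measurableE R).
move: B; apply: sigma_preimage => I [t ->].
rewrite (_ : _ @^-1` _ = setT `\` (setT `&` [set w | T n.+1 w <= t /\ setT (X n.+1 w)])).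
  by apply: sigma_algebraCD; exact: js.
apply/seteqP; split => w /=; rewrite in_itv/= andbT ltNge.
  by move=> /negP Tw; split=> // -[_ []].
by move=> [_ h]; apply/negP => Tw; apply: h.
Qed.

(** Both sides are finite measures of [C], so in the induction step [jump_sets n] is enough; there
    each law reduces step [n.+1] to an integral over step [n], and the induction hypothesis compares
    the integrals. *)
Lemma alive_law n (C : set path) : Fn n C ->
  Ph (alive n `&` to_path @^-1` C) = P (running tau s n `&` C).
Proof.
elim: n C => [|n IH] C FC.
  have mPh : measurable (alive 0 `&` to_path @^-1` C : set (@Omegah R d E)).
    apply: (@Fhn_Omegah _ _ _ 0); apply: FhnI; first exact: Fhn_alive.
    exact: Fhn_to_path.
  have mP : measurable (C : set (@Omega R d E)) by exact: Fn_Omega FC.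
  (* [w0] stands for every path started at [x]: an event of [Fn 0] sees only the initial state, so
     both sides are 0 or both are 1. *)
  rewrite running0 setTI; pose w0 : path := fun _ => (0, x).
  have CP : {ae P, forall w : @Omega R d E, C w <-> C w0}.
    apply: filterS lawP.1 => w Xw; split; apply: (Fn_agree FC) => k;
    by rewrite leqn0 => /eqP->; split.
  have CPh : {ae Ph, forall w : @Omegah R d E,
      (alive 0 `&` to_path @^-1` C) w <-> C w0}.
    apply: filterS lawPh.1 => w Xw; split=> [[_]|Cw0].
      by apply: (Fn_agree FC) => k; rewrite leqn0 => /eqP->; rewrite /X/= Xw.
    split; first by split=> // k; rewrite leqn0 => /eqP->; rewrite Xw.
    by apply: (Fn_agree FC _ Cw0) => k; rewrite leqn0 => /eqP->; rewrite /X/= Xw.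
  have [Cw0|Cw0] := pselect (C w0).
    transitivity (Ph setT); last first.
      rewrite probability_setT -(@probability_setT _ _ _ P); apply: ae_eq_measure => //.
      by apply: filterS CP => w Cw; split=> // _; apply/Cw.
    apply: ae_eq_measure => //.
    by apply: filterS CPh => w Cw; split=> // _; apply/Cw.
  transitivity (Ph set0); last first.
    rewrite measure0 -(measure0 P); apply: ae_eq_measure => //.
    by apply: filterS CP => w Cw; split=> // /Cw.
  apply: ae_eq_measure => //.
  by apply: filterS CPh => w Cw; split=> // /Cw.
have mto : measurable_fun setT (to_path : @Omegah R d E -> OmegaN n.+1).
  move=> _ A mA; rewrite setTI; apply: (@Fhn_Omegah _ _ _ n.+1); exact: Fhn_to_path.
have mton : measurable_fun setT (to_path : @Omegah R d E -> OmegaN n).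
  move=> _ A mA; rewrite setTI; apply: (@Fhn_Omegah _ _ _ n); exact: Fhn_to_path.
have mid k : measurable_fun setT (id : @Omega R d E -> OmegaN k).
  by move=> _ A mA; rewrite setTI; exact: (@Fn_Omega _ _ _ k).
have mal k : measurable (alive k : set (@Omegah R d E)).
  by apply: (@Fhn_Omegah _ _ _ k); exact: Fhn_alive.
have mru k : measurable (running tau s k : set (@Omega R d E)).
  by apply: (@Fn_Omega _ _ _ k); exact: Fn_running.
have FT : Fn n [set: path] by exact: (@measurableT _ (OmegaN n)).
apply: (eq_image_restr (U := OmegaN n.+1) mto (mid n.+1) (mal n.+1) (mru n.+1)
  (G := jump_sets n) (g := fun m => setT `&` [set w | T n.+1 w <= m%:R /\ setT (X n.+1 w)])).
- move=> _ [C' [t [B [FC' mB ->]]]]; apply: FnI; last exact: measurable_le_jump.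
  exact: (@Fn_le _ _ _ n).
- by move=> m; exists setT, m%:R, setT.
- by rewrite -le_bigcup preimage_setT setIT.
- move=> _ _ [C1 [t1 [B1 [F1 m1 ->]]]] [C2 [t2 [B2 [F2 m2 ->]]]].
  exists (C1 `&` C2), (Num.min t1 t2), (B1 `&` B2); split.
  + exact: FnI.
  + exact: measurableI.
  + rewrite setIACA; congr (_ `&` _); apply/seteqP; split=> w /=; rewrite le_min.
      by move=> [[-> ?] [-> ?]].
    by move=> [/andP[-> ->] [? ?]].
- by rewrite (le_lt_trans (probability_le1 _ (mal _)))// ltry.
(* For [t < 0] the laws say nothing; positivity of the jump times makes both events null. *)
- move=> _ [C' [t [B [FC' mB ->]]]]; have [t_lt0|t_ge0] := ltP t 0.
    transitivity (Ph set0).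
      apply: ae_eq_measure => //.
        apply: measurableI => //; apply: (@Fhn_Omegah _ _ _ n.+1); apply: Fhn_to_path.
        by apply: FnI; [exact: (@Fn_le _ _ _ n)|exact: measurable_le_jump].
      apply: filterS Th_gt0 => w /(_ n) Tw; split => // -[_ [_ [+ _]]].
      by rewrite T_to_path leNgt (lt_trans t_lt0).
    rewrite measure0 -(measure0 P); apply: ae_eq_measure => //.
      apply: measurableI => //; apply: (@Fn_Omega _ _ _ n.+1).
      by apply: FnI; [exact: (@Fn_le _ _ _ n)|exact: measurable_le_jump].
    apply: filterS T_gt0 => w /(_ n) Tw; split => // -[_ [_ [+ _]]].
    by rewrite leNgt (lt_trans t_lt0).
  (* Lifting [B] without [Delta] encodes survival of the next jump: the event for [alive n.+1]
     becomes one to which the law of step [n] applies. *)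
  pose Bh : set (option E) := [set y | exists2 z, y = Some z & B z].
  have BhE : Some @^-1` Bh = B.
    by apply/seteqP; split => [y [z [->]]//|y By]; exists y.
  have -> : alive n.+1 `&` to_path @^-1` (C' `&` [set w | T n.+1 w <= t /\ B (X n.+1 w)]) =
      (alive n `&` Ah n @^-1` [set false] `&` to_path @^-1` C') `&`
      [set w | Th n.+1 w <= t /\ Bh (Xh n.+1 w)].
    rewrite aliveS; apply/seteqP; split=> w; rewrite /X /=.
      move=> [[aw Xw] [Cw [Tw Bw]]]; split=> //; split=> //.
      by move: Xw Bw; case: (Xh n.+1 w) => //= y _ By; exists y.
    by move=> [[aw Cw] [Tw [z -> Bz]]].
  have FD : Fhn n (alive n `&` Ah n @^-1` [set false] `&` to_path @^-1` C').
    apply: FhnI; last exact: Fhn_to_path.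
    by apply: FhnI; [exact: Fhn_alive|exact: Fhn_Ah].
  have mBh : mopt Bh by rewrite /mopt BhE.
  apply: (etrans (lawPh.2.2 n _ t Bh FD t_ge0 mBh)).
  pose f : path -> \bar R := (Qdf Q t B \o X n) \_ (C' `&` ~` stops tau s n).
  have f0 w : (0 <= f w)%E by apply: erestrict_ge0 => ? _; exact: measure_ge0.
  transitivity (\int[Ph]_(w in alive n) f (to_path w))%E.
    rewrite integral_mkcond [RHS]integral_mkcond; apply: ge0_ae_integral_eq.
    + move=> w; apply: erestrict_ge0 => v _; rewrite /Qhat.
      by case: (Xh n v) => [y|]; case: (Ah n v); do ?[exact: measure_ge0|case: ifP].
    + by move=> w; apply: erestrict_ge0.
    apply: filterS action_alive => w /(_ n) hA; rewrite !patchE.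
    have [aw|aw] := boolP (w \in alive n); last first.
      by rewrite memNset// => -[[/mem_set]]; rewrite (negbTE aw).
    rewrite inE in aw; have {}hA := hA aw.
    have -> : (w \in alive n `&` Ah n @^-1` [set false] `&` to_path @^-1` C') =
        (to_path w \in C' `&` ~` stops tau s n).
      apply/idP/idP; rewrite !inE/= => -[].
        by move=> [_]; rewrite hA => /asboolPn.
      by move=> Cw /asboolPn; rewrite -hA => /negbTE.
    rewrite /f patchE; case: ifPn => //; rewrite inE /= => -[Cw /asboolPn].
    rewrite -hA => /negbTE ->; have := aw.1 n (leqnn n).
    by rewrite /X/=; case: (Xh n w) => //= y _; rewrite BhE.
  (* The induction hypothesis supplies the equality of the two restricted images. *)
  rewrite (eq_image_restr_integral mton (mid n) (mal n) (mru n) (mu2 := P) (h := f))//; last first.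
    apply/(measurable_restrictT _ _).1.
      by apply: FnI => //; apply: FnC; exact: Fn_stops.
    apply: (measurable_funS measurableT) => //.
    apply: measurableT_comp; first exact: measurable_Qdf.
    exact: measurable_X.
  have FR : Fn n (running tau s n `&` (C' `&` ~` stops tau s n)).
    by apply: FnI; [exact: Fn_running|apply: FnI => //; apply: FnC; exact: Fn_stops].
  rewrite -integral_mkcondr; apply: (etrans (esym (lawP.2 n _ t B FR t_ge0 mB))).
  congr (P _); rewrite runningS; apply/seteqP; split=> w /=.
    by move=> [[? [? ?]] [? ?]].
  by move=> [[? ?] [? [? ?]]].
- exact: Fn_jump_sets.
Qed.

(** The integral form of [alive_law], to be applied to each term of the reward series. *)
Lemma alive_integral n (f : path -> \bar R) :
  measurable_fun setT (f : OmegaN n -> \bar R) -> (forall w, 0 <= f w)%E ->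
  (\int[Ph]_(w in alive n) f (to_path w) = \int[P]_(w in running tau s n) f w)%E.
Proof.
move=> mf f0.
apply: (@eq_image_restr_integral _ _ _ (OmegaN n) _ _ _ Ph P to_path id) => //.
- move=> _ A mA; rewrite setTI; apply: (@Fhn_Omegah _ _ _ n); exact: Fhn_to_path.
- by move=> _ A mA; rewrite setTI; exact: (@Fn_Omega _ _ _ n).
- by apply: (@Fhn_Omegah _ _ _ n); exact: Fhn_alive.
- by apply: (@Fn_Omega _ _ _ n); exact: Fn_running.
- exact: alive_law.
Qed.

End Laws.

(** * Rewards as series *)

Lemma nneseries_single {R : realType} (f : nat -> \bar R) (m : nat) :
  (forall n, 0 <= f n)%E -> (forall n, n != m -> f n = 0%E) ->
  (\sum_(0 <= n <oo) f n = f m)%E.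
Proof.
move=> f0 fm; rewrite (nneseriesD1 (n := m))// eseries0 ?adde0// => n _ /= nm.
exact: fm.
Qed.

Lemma integral_nneseries_patch {d} {T : measurableType d} {R : realType}
    (mu : {measure set T -> \bar R}) (f g : nat -> T -> \bar R) (A B : nat -> set T) :
  (forall n, measurable (A n)) -> (forall n, measurable (B n)) ->
  (forall n, measurable_fun setT (f n)) -> (forall n, measurable_fun setT (g n)) ->
  (forall n x, 0 <= f n x)%E -> (forall n x, 0 <= g n x)%E ->
  (\int[mu]_x (\sum_(0 <= n <oo) ((f n \_ (A n)) x + (g n \_ (B n)) x)) =
   \sum_(0 <= n <oo) (\int[mu]_(x in A n) f n x + \int[mu]_(x in B n) g n x))%E.
Proof.
move=> mA mB mf mg f0 g0.
have mpatch (h : nat -> T -> \bar R) (D : nat -> set T) n :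
    (forall n, measurable (D n)) -> (forall n, measurable_fun setT (h n)) ->
    measurable_fun setT (h n \_ (D n)).
  by move=> mD mh; apply/(measurable_restrictT _ (mD n)).1; exact: (measurable_funS measurableT).
have f0' n x : (0 <= (f n \_ (A n)) x)%E by apply: erestrict_ge0.
have g0' n x : (0 <= (g n \_ (B n)) x)%E by apply: erestrict_ge0.
rewrite integral_nneseries//; last 2 first.
- by move=> n; apply: emeasurable_funD; exact: mpatch.
- by move=> n x _; rewrite adde_ge0.
apply: eq_eseriesr => n _.
rewrite ge0_integralD//; [|exact: mpatch..].
by rewrite -!integral_mkcond.
Qed.

Section Values.
Context {R : realType} {d : measure_display} {E : measurableType d}.
Local Notation path := (@Defs.path R d E).
Local Notation pathh := (@Defs.pathh R d E).
Variables (c g : E -> R) (s : R) (tau : @Omega R d E -> option nat).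
Hypotheses (mc : measurable_fun setT c) (c0 : forall x, 0 <= c x)
  (mg : measurable_fun setT g) (g0 : forall x, 0 <= g x)
  (st : stopping_time tau).

Local Notation to_path := (@to_path R d E).
Local Notation alive := (@alive R d E).
Local Notation stops := (stops tau s).
Local Notation running := (running tau s).

(* The absolute value makes the integrand nonnegative also on the (null) paths
   with negative jumps. *)
Definition seg_cost n (w : path) : \bar R :=
  (c (X n w) * `|overlap s (S n w) (S n.+1 w)|)%:E.

Definition stop_gain n : path -> \bar R := (fun w => (g (X n w))%:E) \_ (stops n).

Lemma seg_cost_ge0 n w : (0 <= seg_cost n w)%E.
Proof. by rewrite lee_fin mulr_ge0. Qed.

Lemma stop_gain_ge0 n w : (0 <= stop_gain n w)%E.
Proof. by apply: erestrict_ge0 => v _; rewrite lee_fin. Qed.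

Lemma measurable_seg_cost n :
  measurable_fun setT (seg_cost n : OmegaN n.+1 -> \bar R).
Proof.
apply/measurable_EFinP; apply: measurable_funM.
  by apply: measurableT_comp => //; exact: measurable_X.
apply: measurableT_comp => //; apply: measurable_funB;
  by apply: measurable_minr => //; exact: measurable_S.
Qed.

Lemma measurable_stop_gain n :
  measurable_fun setT (stop_gain n : OmegaN n -> \bar R).
Proof.
apply/(measurable_restrictT _ _).1; first exact: Fn_stops.
apply: (measurable_funS measurableT) => //; apply/measurable_EFinP.
by apply: measurableT_comp => //; exact: measurable_X.
Qed.

Lemma SE0 (w : path) : S 0 w = 0.
Proof. by rewrite /S big_ord_recl big_ord0 addr0. Qed.

Lemma SES n (w : path) : S n.+1 w = S n w + T n.+1 w.
Proof. by rewrite /S big_ord_recr. Qed.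

(** The cost of interval [n] is charged on [running n.+1], when decision [n] is to continue, while
    the gain at [n] only asks for arrival at step [n]. The indices match those of [alive] for the
    decision process. *)
Definition total_cost (w : path) : \bar R :=
  (\sum_(0 <= n <oo) ((seg_cost n \_ (running n.+1)) w + (stop_gain n \_ (running n)) w))%E.

Lemma cost_intE (f : E -> R) (w : path) u : cost_int f w u =
  (\int[lebesgue_measure]_(t in [set` `[0%R, u]])
     (oapp (fun n => f (X n w)) 0 (seg_index (fun n => S n w) t))%:E)%E.
Proof. by apply: eq_integral => t _; rewrite /Xt; case: seg_index. Qed.

(** [tau'] is only tied to [tau] through the stops before [s], so that the lemma serves both [tau]
    and the induced stopping time. *)
Lemma reward_total_cost (tau' : @Omega R d E -> option nat) (w : path) :
  (forall n, 0 < T n.+1 w) ->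
  (forall n, tau' w = Some n /\ S n w < s <-> stops n w) ->
  reward c g s tau' w = total_cost w.
Proof.
move=> T0 tauE.
have Slt n : S n w < S n.+1 w by rewrite SES ltrDl.
have Sle n : S n w <= S n.+1 w by exact: ltW.
have segE n : seg_cost n w = (c (X n w) * overlap s (S n w) (S n.+1 w))%:E.
  by rewrite /seg_cost ger0_norm// overlap_ge0.
have sc0 n : (0 <= (seg_cost n \_ (running n.+1)) w)%E.
  by apply: erestrict_ge0 => ? _; exact: seg_cost_ge0.
have sg0 n : (0 <= (stop_gain n \_ (running n)) w)%E.
  by apply: erestrict_ge0 => ? _; exact: stop_gain_ge0.
rewrite /total_cost nneseriesD//.
have [[n sn]|nostop] := pselect (exists n, stops n w).
  have [tn Sn] := (tauE n).2 sn.
  rewrite /reward /Stau tn lte_fin Sn /=; congr (_ + _)%E.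
    rewrite cost_intE (integral_segments_stop Sle (SE0 w) (s := s) (n := n))//; last exact: ltW.
    (* Given a stop at [n], the path is in [running k.+1] exactly when [k < n]. *)
    apply: eq_eseriesr => k _; rewrite patchE; case: ltnP => kn.
      rewrite mem_set ?segE// => j; rewrite ltnS => jk sj.
      by have := leq_ltn_trans jk kn; rewrite (stops_uniq sj sn) ltnn.
    by rewrite memNset// => /(_ n kn).
  rewrite (nneseries_single (m := n))//.
    rewrite patchE mem_set; last exact: stops_running.
    (* Strict increase of the jump times puts [S n w] in interval [n], so the state seen at the
       stopping time is [X n w]. *)
    rewrite /stop_gain patchE mem_set// /Xt (@seg_index_in _ _ Sle (S n w) n)//=.
    by rewrite lexx Slt.
  move=> k kn; rewrite patchE; case: ifP => // _; rewrite /stop_gain patchE memNset//.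
  by move=> sk; rewrite (stops_uniq sk sn) eqxx in kn.
have run n : running n w by move=> k _ sk; apply: nostop; exists k.
rewrite [X in (_ + X)%E]eseries0 ?adde0; last first.
  move=> n _ _; rewrite patchE mem_set//= /stop_gain patchE memNset// => sn.
  by apply: nostop; exists n.
have -> : (\sum_(0 <= n <oo) (seg_cost n \_ (running n.+1)) w =
    \sum_(0 <= n <oo) (c (X n w) * overlap s (S n w) (S n.+1 w))%:E)%E.
  by apply: eq_eseriesr => n _; rewrite patchE mem_set// segE.
(* [tau'] is infinite, or finite at a time not before [s]; only the infinite case can end before
   [s], through an explosion. *)
rewrite /reward /Stau; case tw : (tau' w) => [n|].
  rewrite lte_fin; case: ifPn => [Sn|_].
    by exfalso; apply: nostop; exists n; apply/tauE.
  by rewrite cost_intE integral_segments// SE0.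
case: ifPn => [Ss|_]; last by rewrite cost_intE integral_segments// SE0.
rewrite cost_intE (integral_segments_lim Sle (SE0 w) (s := s))//.
(* The explosion time lies in no interval, so [Xt] is [None] there and [g] contributes its default
   0. *)
rewrite [X in (_ + X)%E](_ : _ = 0%E) ?adde0//; congr EFin; rewrite /Xt.
case En : (seg_index _ _) => [n|//]; have /andP[_] := seg_index_some En.
by rewrite ltNge; have /andP[-> _] := seg_le_lim Sle n.+1 Ss.
Qed.

Lemma SE_Sh0 (w : pathh) : Sh 0 w = 0.
Proof. by rewrite -S_to_path SE0. Qed.

Lemma Sh_S n (w : pathh) : Sh n.+1 w = Sh n w + Th n.+1 w.
Proof. by rewrite -!S_to_path SES T_to_path. Qed.

(** The hypotheses on [w] are the almost sure properties of a controlled path. Action 1 runs no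
    cost, and the sojourn after it outlasts the horizon, so the gain of a stop before [s] is the one
    read off at time [s]. *)
Lemma controlled_total_cost (Tm : R) (x : E) (w : pathh) : s <= Tm ->
  Xh 0 w = Some x -> (forall n, 0 < Th n.+1 w) ->
  (forall n, Ah n w -> Tm < Th n.+1 w) ->
  (forall n, alive n w -> Ah n w = false -> alive n.+1 w) ->
  (forall n, alive n w -> Ah n w = `[< stops n (to_path w) >]) ->
  (forall n, ~ alive n w -> Ah n w = true) ->
  (\int[lebesgue_measure]_(t in [set` `[0%R, s]]) (chat_t c w t)%:E + (ghat_t g w s)%:E =
   \sum_(0 <= n <oo) (((seg_cost n \o to_path) \_ (alive n.+1)) w +
                      ((stop_gain n \o to_path) \_ (alive n)) w))%E.
Proof.
move=> sTm X0 T0 Tstop anext act dead.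
have alive0 : alive 0 w.
  by split=> // k; rewrite leqn0 => /eqP->; rewrite X0.
have Slt n : Sh n w < Sh n.+1 w by rewrite Sh_S ltrDl.
have Sle n : Sh n w <= Sh n.+1 w by exact: ltW.
have Shomo : {homo (fun n => Sh n w) : m n / (m <= n)%N >-> m <= n}.
  exact/nondecreasing_seqP.
have Sh0 n : 0 <= Sh n w by rewrite -(SE_Sh0 w); exact: Shomo.
have sc0 n : (0 <= ((seg_cost n \o to_path) \_ (alive n.+1)) w)%E.
  by apply: erestrict_ge0 => ? _; exact: seg_cost_ge0.
have sg0 n : (0 <= ((stop_gain n \o to_path) \_ (alive n)) w)%E.
  by apply: erestrict_ge0 => ? _; exact: stop_gain_ge0.
rewrite nneseriesD//; congr (_ + _)%E.
  have := @integral_segments R (fun n => Sh n w) Sle (SE_Sh0 w)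
    (fun n => chat c (Xh n w) (Ah n w)) s.
  move=> /(_ _)/wrap[]; first by move=> n; rewrite /chat; case: Xh => // y; case: Ah.
  move=> H; apply: (etrans H); apply: eq_eseriesr => n _; rewrite patchE.
  have [an|an] := boolP (w \in alive n.+1); last first.
    (* Outside [alive n.+1] the action is 1 and the cost rate 0: action 0 would give [alive n]
       through [dead], and then [alive n.+1]. *)
    case An : (Ah n w); first by rewrite /chat; case: Xh; rewrite ?mul0r.
    have /anext/(_ An) : alive n w by apply: contrapT => /dead; rewrite An.
    by move=> /mem_set; rewrite (negbTE an).
  rewrite inE in an; have [hX hA] := an.
  rewrite hA//= /seg_cost !S_to_path ger0_norm ?overlap_ge0// /X/=.
  by have := hX n (leqnSn n); case: (Xh n w).
have gain n : alive n w -> Ah n w -> Sh n w < s ->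
  stop_gain n (to_path w) = (ghat g (Xh n w) true)%:E.
  move=> an An Ss; rewrite act// in An; rewrite /stop_gain patchE mem_set; last exact/asboolP.
  by have := an.1 n (leqnn n); rewrite /X/=; case: (Xh n w).
have stopalive n : alive n w -> stops n (to_path w) ->
    seg_index (fun n => Sh n w) s = Some n.
  move=> an sn; apply: (seg_index_in Sle); have := sn.2; rewrite S_to_path => /ltW -> /=.
  (* The sojourn after a stop exceeds [Tm >= s], so the horizon falls in interval [n]. *)
  rewrite Sh_S (le_lt_trans sTm)// (lt_le_trans (Tstop n _)) ?lerDr//.
  by rewrite act//; exact/asboolP.
have [[n [an sn]]|nostop] := pselect (exists n, alive n w /\ stops n (to_path w)).
  rewrite (nneseries_single (m := n))//; last first.
    move=> k kn; rewrite patchE; case: ifP => //; rewrite inE => ak.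
    rewrite /= /stop_gain patchE memNset// => sk.
    have := stopalive _ ak sk; rewrite (stopalive _ an sn) => -[nk].
    by rewrite nk eqxx in kn.
  have An : Ah n w = true by rewrite act//; exact/asboolP.
  rewrite /ghat_t (stopalive _ an sn) patchE mem_set//= gain ?An//.
  by have := sn.2; rewrite S_to_path.
rewrite eseries0; last first.
  move=> n _ _; rewrite patchE; case: ifP => //; rewrite inE => an.
  by rewrite /= /stop_gain patchE memNset// => sn; apply: nostop; exists n.
have allalive n : alive n w.
  elim: n => // n IH; apply: anext => //; rewrite act//; apply/asboolPn => sn.
  by apply: nostop; exists n.
(* Without a stop every action is 0, so the terminal gain vanishes whether or not [s] lies in an
   interval. *)
rewrite /ghat_t; case: seg_index => // n; congr EFin.
have -> : Ah n w = false by rewrite act//; apply/asboolPn => sn; apply: nostop; exists n.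
by rewrite /ghat; case: Xh.
Qed.

End Values.

(** * Equality of the three values *)

Unset Implicit Arguments.

Theorem theorem4p2 (R : realType) (d : measure_display) (E : measurableType d)
  (Q : R.-pker E ~> (R * E)%type)
  (c g : E -> R) (Tm : R)
  (P : E -> probability (@Omega R d E) R)
  (tau : @Omega R d E -> option nat) :
  @borel_space R d E ->
  semi_markov Q ->
  (exists delta eps : R, 0 < delta /\ 0 < eps /\
     forall x, (Qdf Q delta setT x <= (1 - eps)%:E)%E) ->
  measurable_fun setT c -> (forall x, 0 <= c x) ->
  measurable_fun setT g -> (forall x, 0 <= g x) ->
  0 <= Tm ->
  (forall x, smp_law Q x (P x)) ->
  stopping_time tau ->
  forall (s : R) (x : E) (Ph : probability (@Omegah R d E) R),
    0 <= s <= Tm ->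
    smdp_law Q Tm (induced_policy tau) s x Ph ->
    Vtau P c g tau s x = Upi Ph c g s /\
    Upi Ph c g s = Vtau P c g (induced_stop (induced_policy tau) s) s x.
Proof.
move=> _ sQ _ mc c0 mg g0 Tm0 lawP st s x Ph /andP[_ sTm] lawPh.
pose V := (\int[P x]_w total_cost c g s tau w)%E.
have total_ge0 (w : @Omega R d E) : (0 <= total_cost c g s tau w)%E.
  apply: nneseries_ge0 => n _ _; rewrite adde_ge0//; apply: erestrict_ge0 => v _.
    exact: seg_cost_ge0.
  exact: stop_gain_ge0.
have reward_ge0 tau' (w : @Omega R d E) : (0 <= reward c g s tau' w)%E.
  have ci0 u : (0 <= cost_int c w u)%E.
    by apply: integral_ge0 => t _; rewrite lee_fin; case: Xt => /=.
  rewrite /reward; case: ifP => // _; rewrite adde_ge0// lee_fin.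
  by case: Xt => /=.
(* Both [tau] and the induced stopping time satisfy this condition, which fixes only what happens
   before [s]. *)
have VtauE tau' : (forall (w : @Omega R d E) n,
    tau' w = Some n /\ S n w < s <-> stops tau s n w) -> Vtau P c g tau' s x = V.
  move=> tauE; apply: ge0_ae_integral_eq => //.
  apply: filterS (T_gt0 sQ (lawP x)) => w T0.
  by apply: reward_total_cost.
have -> : Upi Ph c g s = V.
  rewrite /Upi /V.
  have mto n : measurable_fun setT (@to_path R d E : @Omegah R d E -> OmegaN n).
    by move=> _ A mA; rewrite setTI; apply: (@Fhn_Omegah _ _ _ n); exact: Fhn_to_path.
  have mid n : measurable_fun setT (id : @Omega R d E -> @OmegaN R d E n).
    by move=> _ A mA; rewrite setTI; exact: (@Fn_Omega _ _ _ n).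
  have mal n : measurable (alive n : set (@Omegah R d E)).
    by apply: (@Fhn_Omegah _ _ _ n); exact: Fhn_alive.
  have mru n : measurable (running tau s n : set (@Omega R d E)).
    by apply: (@Fn_Omega _ _ _ n); exact: Fn_running.
  transitivity (\int[Ph]_w \sum_(0 <= n <oo)
      (((seg_cost c s n \o to_path) \_ (alive n.+1)) w +
       ((stop_gain g s tau n \o to_path) \_ (alive n)) w))%E.
    apply: ge0_ae_integral_eq.
    - move=> w; rewrite adde_ge0//.
        apply: integral_ge0 => t _; rewrite lee_fin /chat_t /chat.
        by case: seg_index => // n; case: Xh => // y; case: Ah.
      rewrite lee_fin /ghat_t /ghat.
      by case: seg_index => // n; case: Xh => // y; case: Ah.
    - move=> w; apply: nneseries_ge0 => n _ _; rewrite adde_ge0//;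
        apply: erestrict_ge0 => v _; [exact: seg_cost_ge0|exact: stop_gain_ge0].
    (* Six almost sure properties are intersected; off the exceptional set the pathwise identity
       holds. *)
    near=> w; apply: (controlled_total_cost c0 g0 sTm (x := x)); near: w.
    + exact: lawPh.1.
    + exact: (Th_gt0 sQ Tm0 lawPh).
    + exact: (Th_stopped Tm0 lawPh).
    + exact: (alive_next lawPh).
    + exact: (action_alive st lawPh).
    + exact: (action_dead lawPh).
  rewrite integral_nneseries_patch//; last 4 first.
  - by move=> n; exact: (measurableT_comp (measurable_seg_cost s mc (n := n)) (mto n.+1)).
  - by move=> n; exact: (measurableT_comp (measurable_stop_gain s mg st (n := n)) (mto n)).
  - by move=> n w; exact: seg_cost_ge0.
  - by move=> n w; exact: stop_gain_ge0.
  rewrite [RHS]integral_nneseries_patch//; last 4 first.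
  - by move=> n; exact: (measurableT_comp (measurable_seg_cost s mc (n := n)) (mid n.+1)).
  - by move=> n; exact: (measurableT_comp (measurable_stop_gain s mg st (n := n)) (mid n)).
  - by move=> n w; exact: seg_cost_ge0.
  - by move=> n w; exact: stop_gain_ge0.
  (* Interval costs involve [S n.+1], hence [alive_integral] at [n.+1]; gains use it at [n]. *)
  apply: eq_eseriesr => n _; congr (_ + _)%E.
    apply: (alive_integral sQ Tm0 st (lawP x) lawPh).
      exact: measurable_seg_cost.
    by move=> w; exact: seg_cost_ge0.
  apply: (alive_integral sQ Tm0 st (lawP x) lawPh).
    exact: measurable_stop_gain.
  by move=> w; exact: stop_gain_ge0.
split; first exact: VtauE.
apply/esym/VtauE => w n; rewrite -(induced_stop_stops s st).
(* A finite value of the induced stopping time already places the stop before [s]. *)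
by split=> [[]//|iw]; split=> //; have [] := (induced_stop_stops s st n w).1 iw.
Unshelve. all: by end_near.
Qed.
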